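(* Let $I=[a,b]$, $a<b$, be a compact interval. For every $0<\alpha<1$ and every integer $n\ge2$, there exist a left-continuous nondecreasing map $g:I\to\mathbb R$, a map $F:I\to\mathcal K_c(\mathbb R^n)$ with $[F]_{\alpha,g}=1$, a point $\theta\in I$, and a point $x_\theta\in F(\theta)$ such that no selection $f:I\to\mathbb R^n$ of $F$ satisfying $f(\theta)=x_\theta$ can satisfy $[f]_{\alpha,g}\le1$.
   Context: $\mathcal K_c(\mathbb R^n)$ is the family of nonempty compact convex subsets of Euclidean $\mathbb R^n$, with Hausdorff distance $d_H$ induced by the Euclidean norm. A selection of $F$ is a map $f:I\to\mathbb R^n$ with $f(t)\in F(t)$ for all $t\in I$. $F$ is $g$-Hölder of exponent $\alpha$ if there is $L\ge0$ with $d_H(F(s),F(t))\le L|g(t)-g(s)|^\alpha$ for all $s,t\in I$; $[F]_{\alpha,g}$ is the minimum such $L$ (so $[F]_{\alpha,g}=1$ includes that $F$ is $g$-Hölder of exponent $\alpha$). $[f]_{\alpha,g}\le1$ means $\|f(s)-f(t)\|\le|g(t)-g(s)|^\alpha$ for all $s,t\in I$. *)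

(* Defs.v *)
From HB Require Import structures.
From mathcomp Require Import all_boot all_order all_algebra.
From mathcomp Require Import all_classical all_reals all_analysis.
Set Implicit Arguments.
Unset Strict Implicit.
Unset Printing Implicit Defensive.
Import Order.TTheory GRing.Theory Num.Theory.
Import numFieldNormedType.Exports.
Local Open Scope classical_set_scope.
Local Open Scope ring_scope.

(* The canonical norm [`|x|] on ['rV[R]_n] is the sup norm, whence this
   separate Euclidean norm.  Both induce the same topology, so [compact] below
   is the usual notion. *)
Definition enorm (R : realType) (n : nat) (x : 'rV[R]_n) : R :=
  Num.sqrt (\sum_(i < n) x 0 i ^+ 2).

Definition dist_to_set (R : realType) (n : nat) (x : 'rV[R]_n)
  (A : set 'rV[R]_n) : R := inf [set enorm (x - y) | y in A].

(* Meaningful for nonempty bounded sets, where the suprema and infima are taken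
   over nonempty bounded sets of reals. *)
Definition hausdorff_dist (R : realType) (n : nat) (A B : set 'rV[R]_n) : R :=
  Num.max (sup [set dist_to_set x B | x in A])
          (sup [set dist_to_set y A | y in B]).

Definition compact_convex (R : realType) (n : nat) : set (set 'rV[R]_n) :=
  [set A | [/\ A !=set0, compact A & @convex_set R 'rV[R]_n A]].

(* A map on [I = [a, b]] is represented by a total function on [R] of which only
   the values on [`[a, b]] are used. *)

Definition nondecreasing_on (R : realType) (a b : R) (g : R -> R) : Prop :=
  {in `[a, b] &, {homo g : s t / s <= t}}.

(* Left-continuity at [a] is vacuous for a map defined on [[a, b]] only. *)
Definition left_continuous_on (R : realType) (a b : R) (g : R -> R) : Prop :=
  {in `]a, b], forall t, g s @[s --> t^'-] --> g t}.

Definition selection (R : realType) (n : nat) (a b : R)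
  (F : R -> set 'rV[R]_n) (f : R -> 'rV[R]_n) : Prop :=
  {in `[a, b], forall t, F t (f t)}.

Definition holder_consts (R : realType) (n : nat) (a b : R) (g : R -> R)
  (alpha : R) (F : R -> set 'rV[R]_n) : set R :=
  [set L | 0 <= L /\
    {in `[a, b] &, forall s t,
       hausdorff_dist (F s) (F t) <= L * `|g t - g s| `^ alpha}].

(* [F]_{alpha,g} = L, as the minimum Hoelder constant: in particular [F] is
   g-Hoelder of exponent alpha. *)
Definition holder_seminorm_eq (R : realType) (n : nat) (a b : R) (g : R -> R)
  (alpha : R) (F : R -> set 'rV[R]_n) (L : R) : Prop :=
  holder_consts a b g alpha F L /\ lbound (holder_consts a b g alpha F) L.

(* [f]_{alpha,g} <= 1 *)
Definition holder_seminorm_le1 (R : realType) (n : nat) (a b : R) (g : R -> R)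
  (alpha : R) (f : R -> 'rV[R]_n) : Prop :=
  {in `[a, b] &, forall s t, enorm (f s - f t) <= `|g t - g s| `^ alpha}.

(* Main.v *)
Require Import Defs.
(* Let [g] be the step function with values 0, 1, 2, so that the squeezed
   distance between its extreme values is [2 `^ alpha < 2 = 1 + 1].  Put
   [s ^+ 2 = 2 `^ alpha / 2] and [s ^+ 2 + c ^+ 2 = 1].  The outer values of [F]
   are two mirror-image segments issuing from the unit vectors [(-s, c)] and
   [(s, c)] along the tangents to the unit circle, each ending at the orthogonal
   projection of the other's starting point, so that the Hausdorff distance of
   the two is [2 s^2 = 2 `^ alpha]; the middle value is a segment from the
   origin, at distance 1 from both.  A selection through the origin with
   constant 1 must take the nearest points [(-s, c)] and [(s, c)] as its outer
   values, but these are [2 s > 2 s^2 = 2 `^ alpha] apart. *)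
From HB Require Import structures.
From mathcomp Require Import all_boot all_order all_algebra.
From mathcomp Require Import all_classical all_reals all_analysis.
From mathcomp Require Import ring lra.
Set Implicit Arguments.
Unset Strict Implicit.
Unset Printing Implicit Defensive.
Import Order.TTheory GRing.Theory Num.Theory.
Import numFieldNormedType.Exports.
Local Open Scope classical_set_scope.
Local Open Scope ring_scope.

(** * Euclidean norm *)

Lemma sqrtr_leE (R : realType) (x M : R) : 0 <= M ->
  (Num.sqrt x <= M) = (x <= M ^+ 2).
Proof.
by move=> M0; rewrite -{1}(ger0_norm M0) -sqrtr_sqr ler_sqrt// sqr_ge0.
Qed.

Lemma sqrtr_geE (R : realType) (x M : R) : 0 <= M -> 0 <= x ->
  (M <= Num.sqrt x) = (M ^+ 2 <= x).
Proof.
by move=> M0 x0; rewrite -{1}(ger0_norm M0) -sqrtr_sqr ler_sqrt.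
Qed.

Lemma enorm_ge0 (R : realType) (n : nat) (x : 'rV[R]_n) : 0 <= enorm x.
Proof. exact: sqrtr_ge0. Qed.

Lemma enorm0 (R : realType) (n : nat) : enorm (0 : 'rV[R]_n) = 0.
Proof.
by rewrite /enorm big1 ?sqrtr0// => i _; rewrite mxE expr0n.
Qed.

Lemma enormN (R : realType) (n : nat) (x : 'rV[R]_n) : enorm (- x) = enorm x.
Proof. by congr Num.sqrt; apply: eq_bigr => i _; rewrite mxE sqrrN. Qed.

Lemma enorm_distC (R : realType) (n : nat) (x y : 'rV[R]_n) :
  enorm (x - y) = enorm (y - x).
Proof. by rewrite -enormN opprB. Qed.

Lemma enorm_le (R : realType) (n : nat) (x : 'rV[R]_n) (M : R) :
  0 <= M -> (enorm x <= M) = (\sum_(i < n) x 0 i ^+ 2 <= M ^+ 2).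
Proof. exact: sqrtr_leE. Qed.

(** After squaring, this is the convexity of the square in each coordinate, with gap
    [t (1 - t) (u_i - v_i)^2]. *)
Lemma enorm_conv (R : realType) (n : nat) (u v : 'rV[R]_n) (t M : R) :
  0 <= t <= 1 -> enorm u <= M -> enorm v <= M ->
  enorm ((1 - t) *: u + t *: v) <= M.
Proof.
move=> /andP[t0 t1] uM; have M0 := le_trans (enorm_ge0 u) uM; move: uM.
rewrite !enorm_le// => uM vM.
rewrite (_ : M ^+ 2 = (1 - t) * M ^+ 2 + t * M ^+ 2); last by ring.
apply: (@le_trans _ _ (\sum_(i < n)
  ((1 - t) * u 0 i ^+ 2 + t * v 0 i ^+ 2))).
  apply: ler_sum => i _; rewrite !mxE -subr_ge0.
  rewrite (_ : _ - _ = t * (1 - t) * (u 0 i - v 0 i) ^+ 2); last by ring.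
  by rewrite mulr_ge0 ?sqr_ge0// mulr_ge0 ?subr_ge0.
by rewrite big_split -!mulr_sumr; apply: lerD; rewrite ler_wpM2l ?subr_ge0.
Qed.

(** * Hausdorff distance, segments and the coordinate plane *)

Section Distance.
Variables (R : realType) (n : nat).
Implicit Types (x y P Q : 'rV[R]_n) (A B : set 'rV[R]_n).

Lemma dist_to_set_le x y A : A y -> dist_to_set x A <= enorm (x - y).
Proof.
move=> Ay; apply: ge_inf; last by exists y.
by exists 0 => _ [z _ <-]; exact: enorm_ge0.
Qed.

Lemma dist_to_set_ge x A M : A !=set0 ->
  (forall y, A y -> M <= enorm (x - y)) -> M <= dist_to_set x A.
Proof.
move=> [y Ay] h; apply: lb_le_inf; first by exists (enorm (x - y)), y.
by move=> _ [z Az <-]; exact: h.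
Qed.

Lemma hausdorff_distC A B : hausdorff_dist A B = hausdorff_dist B A.
Proof. by rewrite /hausdorff_dist maxC. Qed.

Lemma hausdorff_dist_le A B M : A !=set0 -> B !=set0 ->
  (forall x, A x -> exists2 y, B y & enorm (x - y) <= M) ->
  (forall y, B y -> exists2 x, A x & enorm (y - x) <= M) ->
  hausdorff_dist A B <= M.
Proof.
move=> [p Ap] [q Bq] hA hB; rewrite /hausdorff_dist ge_max; apply/andP; split.
  apply: ge_sup; first by exists (dist_to_set p B), p.
  move=> _ [x Ax <-]; have [y By xy] := hA x Ax.
  exact: le_trans (dist_to_set_le x By) xy.
apply: ge_sup; first by exists (dist_to_set q A), q.
move=> _ [y By <-]; have [x Ax xy] := hB y By.
exact: le_trans (dist_to_set_le y Ax) xy.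
Qed.

(** The bound [M] makes the set of distances bounded above; for an unbounded set [sup] would be a
    default value. *)
Lemma dist_to_set_le_hausdorff A B x M : A x ->
  (forall y, A y -> exists2 z, B z & enorm (y - z) <= M) ->
  dist_to_set x B <= hausdorff_dist A B.
Proof.
move=> Ax h; rewrite /hausdorff_dist le_max; apply/orP; left.
apply: ub_le_sup; last by exists x.
exists M => _ [y Ay <-]; have [z Bz yz] := h y Ay.
exact: le_trans (dist_to_set_le y Bz) yz.
Qed.

Definition segment_set P Q : set 'rV[R]_n :=
  [set (1 - t) *: P + t *: Q | t in `[0, 1]].

Lemma segment_setC P Q : segment_set P Q = segment_set Q P.
Proof.
by apply/seteqP; split=> x [t]; rewrite /= in_itv/= => /andP[t0 t1] <-;
  exists (1 - t); rewrite ?subKr 1?addrC// /= in_itv/=; lra.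
Qed.

Lemma segment_set_left P Q : segment_set P Q P.
Proof.
by exists 0; rewrite ?subr0 ?scale1r ?scale0r ?addr0//= in_itv/= lexx ler01.
Qed.

Lemma segment_set_nonempty P Q : segment_set P Q !=set0.
Proof. by exists P; exact: segment_set_left. Qed.

Lemma segment_set_compact_convex P Q : compact_convex (segment_set P Q).
Proof.
split; first exact: segment_set_nonempty.
  apply: continuous_compact; last exact: segment_compact.
  apply: continuous_subspaceT => t.
  apply: cvgD; apply: cvgZr_tmp.
    by apply: cvgB; [exact: cvg_cst|exact: cvg_id].
  exact: cvg_id.
move=> x y k; rewrite !inE => -[t + <-] [u + <-].
rewrite /= !in_itv/= => /andP[t0 t1] /andP[u0 u1].
have k0 : 0 <= k%:num by [].
have k1 : k%:num <= 1 by [].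
exists (k%:num * t + (1 - k%:num) * u).
  by rewrite /= in_itv/=; apply/andP; split; nra.
by rewrite /conv/=; apply/rowP => i; rewrite !mxE /unstable.onem; ring.
Qed.

(** Points with the same parameter are matched: their difference is a convex combination of the
    differences of the endpoints. *)
Lemma segment_set_near P Q P' Q' M :
  enorm (P - P') <= M -> enorm (Q - Q') <= M ->
  forall x, segment_set P Q x ->
    exists2 y, segment_set P' Q' y & enorm (x - y) <= M.
Proof.
move=> hP hQ _ [t ht <-]; exists ((1 - t) *: P' + t *: Q'); first by exists t.
rewrite opprD addrACA -!scalerBr; exact: enorm_conv.
Qed.

Lemma hausdorff_dist_segment P Q P' Q' M :
  enorm (P - P') <= M -> enorm (Q - Q') <= M ->
  hausdorff_dist (segment_set P Q) (segment_set P' Q') <= M.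
Proof.
move=> hP hQ; apply: hausdorff_dist_le; try exact: segment_set_nonempty.
  exact: segment_set_near.
by apply: segment_set_near; rewrite enorm_distC.
Qed.

Definition plane_point (u v : R) : 'rV[R]_n :=
  \row_i (if val i == 0%N then u else if val i == 1%N then v else 0).

Lemma plane_pointB u v u' v' :
  plane_point u v - plane_point u' v' = plane_point (u - u') (v - v').
Proof.
apply/rowP => i; rewrite !mxE; case: ifP => // _; case: ifP => // _.
by rewrite subr0.
Qed.

Lemma plane_point_conv t u v u' v' :
  (1 - t) *: plane_point u v + t *: plane_point u' v' =
  plane_point ((1 - t) * u + t * u') ((1 - t) * v + t * v').
Proof.
apply/rowP => i; rewrite !mxE; case: ifP => // _; case: ifP => // _.
by rewrite !mulr0 addr0.
Qed.

Lemma enorm_plane_point u v : (2 <= n)%N ->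
  enorm (plane_point u v) = Num.sqrt (u ^+ 2 + v ^+ 2).
Proof.
rewrite /enorm /plane_point; case: n => [//|[//|m]] _.
rewrite !big_ord_recl !mxE/= big1 ?addr0// => i _.
by rewrite !mxE/= expr0n.
Qed.

End Distance.

(** * The three segments and their mutual distances *)

Section Segments.
Variables (R : realType) (n : nat) (s c : R).
Hypotheses (hn : (2 <= n)%N) (s0 : 0 < s) (c0 : 0 < c)
  (sc : s ^+ 2 + c ^+ 2 = 1).

(** The upper end is the midpoint of the ends of the two side segments, so that matching endpoints
    yields distance at most 1. *)
Definition middle_segment : set 'rV[R]_n :=
  segment_set 0 (plane_point n 0 (c + 2 * s ^+ 2 * c)).

(** The sign [e = 1] or [e = -1] selects the side. The end is the start plus [2 s c] times the unit
    tangent [(- e c, s)]. *)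
Definition side_segment (e : R) : set 'rV[R]_n :=
  segment_set (plane_point n (e * s) c)
    (plane_point n (e * (s - 2 * s * c ^+ 2)) (c + 2 * s ^+ 2 * c)).

Variable e : R.
Hypothesis e2 : e ^+ 2 = 1.

Let c2 : c ^+ 2 = 1 - s ^+ 2. Proof. by move: sc; lra. Qed.

Let s2_lt1 : s ^+ 2 < 1. Proof. by rewrite -subr_gt0 -c2 exprn_gt0. Qed.

Let start_close : enorm (0 - plane_point n (e * s) c) <= 1.
Proof.
rewrite sub0r enormN enorm_plane_point// sqrtr_leE//.
by rewrite exprMn e2 mul1r sc expr1n.
Qed.

Let end_close : enorm (plane_point n 0 (c + 2 * s ^+ 2 * c) -
  plane_point n (e * (s - 2 * s * c ^+ 2)) (c + 2 * s ^+ 2 * c)) <= 1.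
Proof.
rewrite enorm_distC plane_pointB enorm_plane_point// sqrtr_leE//.
rewrite !subr0 subrr c2 exprMn e2.
have : 0 <= s ^+ 2 by exact: sqr_ge0.
(* For [q = s^2] in [[0, 1)], both [q] and [(1 - 2 q)^2] are at most 1. *)
rewrite (_ : _ + _ = s ^+ 2 * (1 - 2 * s ^+ 2) ^+ 2); last by ring.
move: s2_lt1; set q := s ^+ 2 => q1 q0.
nra.
Qed.

Lemma hausdorff_dist_middle_side_le :
  hausdorff_dist middle_segment (side_segment e) <= 1.
Proof. exact: hausdorff_dist_segment. Qed.

Lemma side_segment_param x : side_segment e x -> exists2 t, 0 <= t &
  x = plane_point n (e * (s - 2 * s * c ^+ 2 * t)) (c + 2 * s ^+ 2 * c * t).
Proof.
move=> [t]; rewrite /= in_itv/= => /andP[t0 _] <-; exists t => //.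
by rewrite plane_point_conv; congr plane_point; ring.
Qed.

(** Pythagoras: the start is a unit vector, and the displacement from it is orthogonal to it, of
    length [2 s c t]. *)
Lemma enorm_side_segment_point t :
  enorm (plane_point n (e * (s - 2 * s * c ^+ 2 * t))
                       (c + 2 * s ^+ 2 * c * t)) =
  Num.sqrt (1 + (2 * s * c * t) ^+ 2).
Proof.
rewrite enorm_plane_point// exprMn e2; congr Num.sqrt.
transitivity (s ^+ 2 + c ^+ 2 + (2 * s * c * t) ^+ 2 * (s ^+ 2 + c ^+ 2)).
  by ring.
by rewrite sc mulr1.
Qed.

Lemma side_segment_enorm_ge1 x : side_segment e x -> 1 <= enorm x.
Proof.
move=> /side_segment_param[t t0 ->].
rewrite enorm_side_segment_point sqrtr_geE//.
  by rewrite expr1n lerDl sqr_ge0.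
by rewrite addr_ge0// sqr_ge0.
Qed.

(** A tangent meets the closed unit ball only at its point of contact: as [s c > 0], the excess
    [(2 s c t)^2] vanishes only for [t = 0]. *)
Lemma side_segment_nearest x : side_segment e x -> enorm x <= 1 ->
  x = plane_point n (e * s) c.
Proof.
move=> /side_segment_param[t t0 ->].
rewrite enorm_side_segment_point sqrtr_leE// expr1n.
rewrite gerDl => h.
have : (2 * s * c * t) ^+ 2 == 0 by rewrite eq_le h sqr_ge0.
rewrite sqrf_eq0 !mulf_eq0 (gt_eqF s0) (gt_eqF c0) pnatr_eq0/= => /eqP ->.
by rewrite !mulr0 subr0 addr0.
Qed.

Lemma hausdorff_dist_side_opp_le :
  hausdorff_dist (side_segment e) (side_segment (- e)) <= 2 * s ^+ 2.
Proof.
have M0 : 0 <= 2 * s ^+ 2 by rewrite mulr_ge0 ?sqr_ge0.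
(* Each starting point is compared with the far end of the other segment. *)
rewrite [side_segment (- e)]segment_setC; apply: hausdorff_dist_segment.
all: rewrite plane_pointB enorm_plane_point// sqrtr_leE// c2.
(* Each difference is [2 s^2] times one of the unit vectors [(e s, c)] and [(e s, - c)]. *)
all: rewrite (_ : _ + _ = 4 * s ^+ 4 * (e ^+ 2 * s ^+ 2 + c ^+ 2));
  last by ring.
all: by rewrite e2 mul1r sc mulr1 exprMn -exprM -natrX.
Qed.

(** The origin lies in the middle segment, while the side segment stays outside the open unit ball.
    This lower bound makes the Hölder constant of [F] exactly 1. *)
Lemma hausdorff_dist_middle_side_ge :
  1 <= hausdorff_dist middle_segment (side_segment e).
Proof.
apply: le_trans (dist_to_set_le_hausdorff (segment_set_left _ _)
  (segment_set_near start_close end_close)).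
apply: dist_to_set_ge; first exact: segment_set_nonempty.
by move=> y /side_segment_enorm_ge1; rewrite sub0r enormN.
Qed.

End Segments.

(** This is where [alpha < 1] enters: it puts half of the [alpha]-th power of 2 strictly between 0
    and 1, so that it is the squared sine of an acute angle. *)
Lemma exists_half_powR2_pythagorean (R : realType) (alpha : R) : alpha < 1 ->
  exists s c : R, [/\ 0 < s, 0 < c, s ^+ 2 + c ^+ 2 = 1 &
                     2 `^ alpha = 2 * s ^+ 2].
Proof.
move=> alpha1; have p0 : 0 < 2 `^ alpha :> R by rewrite powR_gt0.
have p2 : 2 `^ alpha < 2 :> R.
  rewrite -[ltRHS]powRr1// /powR pnatr_eq0/= ltr_expR ltr_pM2r// ln_gt0//.
  by rewrite ltr1n.
exists (Num.sqrt (2 `^ alpha / 2)), (Num.sqrt (1 - 2 `^ alpha / 2)).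
have h0 : 0 < 2 `^ alpha / 2 :> R by rewrite divr_gt0.
have h1 : 0 < 1 - 2 `^ alpha / 2 :> R by lra.
rewrite !sqrtr_gt0 !sqr_sqrtr ?ltW//; split=> //; lra.
Qed.

Lemma near_left_ltr (R : realType) (x t : R) :
  \forall u \near t^'-, (x < u) = (x < t).
Proof.
have [xt|tx] := ltP x t; first exact: nbhs_left_gt.
near=> u; apply/negbTE; rewrite -leNgt (le_trans _ tx)// ltW//.
Unshelve. all: by end_near. Qed.

(** * The step function and the set-valued map *)

Section Counterexample.
Variables (R : realType) (a b alpha : R) (n : nat) (s c : R).
Hypotheses (hab : a < b) (alpha0 : 0 < alpha) (hn : (2 <= n)%N) (s0 : 0 < s)
  (c0 : 0 < c) (sc : s ^+ 2 + c ^+ 2 = 1) (alphaE : 2 `^ alpha = 2 * s ^+ 2).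

Let mid := (a + b) / 2.

(** On [[a, b]] the value is 0 only at [a], 1 up to and including [mid], and 2 beyond. The strict
    comparisons place each jump just to the right of its point, whence left-continuity. *)
Definition step_index (t : R) : nat := ((a < t)%R + (mid < t)%R)%N.

Definition step_segment (k : nat) : set 'rV[R]_n :=
  if k == 0%N then side_segment s c (- 1)
  else if k == 1%N then middle_segment s c else side_segment s c 1.

Let am : a < mid. Proof. by case: (midf_lt hab). Qed.
Let mb : mid < b. Proof. by case: (midf_lt hab). Qed.

Lemma step_index_left : step_index a = 0%N.
Proof. by rewrite /step_index ltxx ltNge ltW. Qed.

Lemma step_index_mid : step_index mid = 1%N.
Proof. by rewrite /step_index ltxx am. Qed.

Lemma step_index_right : step_index b = 2%N.
Proof. by rewrite /step_index hab mb. Qed.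

Lemma step_index_le2 t : (step_index t <= 2)%N.
Proof. by rewrite /step_index; do 2 case: (_ < _). Qed.

Lemma step_index_homo : {homo step_index : x y / x <= y >-> (x <= y)%N}.
Proof.
move=> x y xy; rewrite /step_index; apply: leq_add.
  by case: (ltP a x) => // ax; rewrite (lt_le_trans ax xy).
by case: (ltP mid x) => // ax; rewrite (lt_le_trans ax xy).
Qed.

Lemma step_index_left_continuous (t : R) :
  (step_index u)%:R @[u --> t^'-] --> ((step_index t)%:R : R).
Proof.
apply: cvg_near_cst.
apply: filterS2 (near_left_ltr a t) (near_left_ltr mid t) => u.
by rewrite /step_index => -> ->.
Qed.

Lemma step_segment_compact_convex k : compact_convex (step_segment k).
Proof.
by rewrite /step_segment; case: ifP => _; [|case: ifP => _];
  exact: segment_set_compact_convex.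
Qed.

Lemma hausdorff_dist_step_segment i j : (i <= 2)%N -> (j <= 2)%N ->
  hausdorff_dist (step_segment i) (step_segment j) <= `|j%:R - i%:R| `^ alpha.
Proof.
wlog ij : i j / (i <= j)%N => [h|] i2 j2.
  have [ij|/ltnW ji] := leqP i j; first exact: h.
  by rewrite hausdorff_distC distrC; exact: h.
have [<-|ne] := eqVneq i j.
  (* As [alpha > 0], the bound is 0 here, and each point is its own partner. *)
  rewrite subrr normr0 powR0 ?gt_eqF//.
  have [A0 _ _] := step_segment_compact_convex i.
  by apply: hausdorff_dist_le => // x Ax; exists x; rewrite // subrr enorm0.
have en1 : (- 1) ^+ 2 = 1 :> R by rewrite sqrrN expr1n.
have e1 : 1 ^+ 2 = 1 :> R by rewrite expr1n.
rewrite -natrB// ger0_norm//.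
have : [\/ i = 0%N /\ j = 1%N, i = 1%N /\ j = 2%N | i = 0%N /\ j = 2%N].
  by move: i j ij i2 j2 ne => [|[|[|i]]] [|[|[|j]]]// _ _ _ _;
    [constructor 1|constructor 3|constructor 2].
case=> -[-> ->]; rewrite /step_segment/=.
- rewrite subn0 powR1 hausdorff_distC.
  exact: hausdorff_dist_middle_side_le.
- rewrite subSnn powR1.
  exact: hausdorff_dist_middle_side_le.
- have := hausdorff_dist_side_opp_le hn sc en1.
  by rewrite opprK subn0 alphaE.
Qed.

Lemma step_no_selection (f : R -> 'rV[R]_n) :
  selection a b (step_segment \o step_index) f -> f mid = 0 ->
  ~ holder_seminorm_le1 a b (fun t => (step_index t)%:R) alpha f.
Proof.
have Ia : a \in `[a, b] by rewrite in_itv/= lexx ltW.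
have Ib : b \in `[a, b] by rewrite in_itv/= lexx ltW.
have Im : mid \in `[a, b] by rewrite in_itv/= !ltW.
move=> fF fm fL.
(* A unit step of [g] from [f mid = 0] confines [f a] to the closed unit ball, where its segment has
   a single point. *)
have fa : f a = plane_point n (- 1 * s) c.
  apply: side_segment_nearest => //; first by rewrite sqrrN expr1n.
    by have := fF a Ia; rewrite /= step_index_left.
  have := fL a mid Ia Im.
  by rewrite fm subr0 step_index_left step_index_mid subr0 normr1 powR1.
have fb : f b = plane_point n (1 * s) c.
  apply: side_segment_nearest => //; first by rewrite expr1n.
    by have := fF b Ib; rewrite /= step_index_right.
  have := fL mid b Im Ib.
  rewrite enorm_distC fm subr0 step_index_right step_index_mid.
  by rewrite (_ : 2 - 1 = 1) ?normr1 ?powR1//; ring.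
have := fL b a Ib Ia; apply/negP; rewrite -ltNge.
rewrite step_index_left step_index_right sub0r normrN normr_nat alphaE.
rewrite fa fb plane_pointB enorm_plane_point// subrr expr0n/= addr0 sqrtr_sqr.
rewrite mulN1r mul1r opprK ger0_norm ?addr_ge0 ?ltW//.
(* What remains is [2 s^2 < 2 s], that is [s < 1], which follows from [c > 0]. *)
have c2 : 0 < c ^+ 2 by rewrite exprn_gt0.
have s1 : s < 1.
  by rewrite -(ltr_pXn2r (isT : 0 < 2)%N) ?nnegrE ?ltW// expr1n -sc ltrDl.
have : 0 < s * (1 - s) by rewrite mulr_gt0 ?subr_gt0.
lra.
Qed.

End Counterexample.

Theorem theorem11p3 (R : realType) (a b : R) (hab : a < b)
    (alpha : R) (halpha0 : 0 < alpha) (halpha1 : alpha < 1)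
    (n : nat) (hn : (2 <= n)%N) :
  exists (g : R -> R) (F : R -> set 'rV[R]_n) (theta : R) (xtheta : 'rV[R]_n),
    left_continuous_on a b g /\
    nondecreasing_on a b g /\
    (forall t, t \in `[a, b] -> compact_convex (F t)) /\
    holder_seminorm_eq a b g alpha F 1 /\
    theta \in `[a, b] /\
    F theta xtheta /\
    (forall f : R -> 'rV[R]_n,
       selection a b F f -> f theta = xtheta ->
       ~ holder_seminorm_le1 a b g alpha f).
Proof.
have [s [c [s0 c0 sc alphaE]]] := exists_half_powR2_pythagorean halpha1.
have [am mb] := midf_lt hab.
have Ia : a \in `[a, b] by rewrite in_itv/= lexx ltW.
have Im : (a + b) / 2 \in `[a, b] by rewrite in_itv/= !ltW.
exists (fun t => (step_index a b t)%:R), (step_segment s c \o step_index a b).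
exists ((a + b) / 2), 0.
split; [|split; [|split; [|split; [|split; [|split]]]]].
- by move=> t _; exact: step_index_left_continuous.
- by move=> x y _ _ xy; rewrite ler_nat step_index_homo.
- by move=> t _; exact: step_segment_compact_convex.
- split.
    split=> // x y _ _; rewrite mul1r.
    by apply: hausdorff_dist_step_segment => //; exact: step_index_le2.
  (* Minimality is tested on the midpoint and [a]: there [g] changes by 1 and the sets are at
     distance at least 1, so [1 <= L]. *)
  move=> L [L0 /(_ _ _ Im Ia)]; rewrite /= step_index_left// step_index_mid//.
  rewrite sub0r normrN normr1 powR1 mulr1; apply: le_trans.
  by apply: hausdorff_dist_middle_side_ge => //; rewrite sqrrN expr1n.
- exact: Im.
- by rewrite /= step_index_mid//; exact: segment_set_left.
- by move=> f; exact: step_no_selection.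
Qed.
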